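(* There exist a filtered measurable space with a family $\mathcal M$ of probability measures, two null hypotheses $H_1,H_2\subseteq\mathcal M$ that are both true (under some $P\in\mathcal M$, i.e. $P\in H_1\cap H_2$), deterministic active sets $I_t\subseteq\{1,2\}$, and a dynamic intersection $e$-process collection $\mathbf E=(E^S_t)$ for which every fixed-intersection process $E^S$ ($\varnothing\ne S\subseteq\{1,2\}$) is a nonnegative test martingale for $H_S$, but the induced dynamic $e$-closure at level $\alpha=1/2$ has stopped FDR equal to one: there is an almost surely finite stopping time $\tau$ with $$\mathbb E_P\Big[\max_{R\in\mathfrak R_{1/2,\tau}(\mathbf E)}\mathrm{FDP}_{\{1,2\}}(R)\Big]=1 .$$ Hence the assumption that $E^S$ is an $e$-process for $H_S$ for every fixed nonempty finite $S$ does not by itself imply that $(\mathfrak R_{\alpha,t}(\mathbf E))_{t\ge0}$ controls simultaneous stopped FDR at level $\alpha$.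
   Context: Setting: $(\Omega,\mathcal F,(\mathcal F_t)_{t\in\mathbb N_0})$ is a discrete-time filtered measurable space, $\mathcal M$ a family of probability measures on it, $H_i\subseteq\mathcal M$ null hypotheses for $i\in\mathcal I$ (here $\mathcal I=\{1,2\}$), $\mathcal N(P)=\{i\in\mathcal I:P\in H_i\}$, and $H_S=\bigcap_{i\in S}H_i$. The active sets $I_t\subseteq\mathcal I$ are deterministic and finite with $I_0\subseteq I_1\subseteq\cdots$ and $\bigcup_t I_t=\mathcal I$. For a finite $R\subseteq\mathcal I$ and $S\subseteq\mathcal I$, $\mathrm{FDP}_S(R)=|S\cap R|/(|R|\vee1)$. A nonnegative $(\mathcal F_t)$-adapted process $E$ is an $e$-process for $H\subseteq\mathcal M$ if $\mathbb E_P[E_\tau]\le1$ for every $P\in H$ and every $(\mathcal F_t)$-stopping time $\tau$ with $P(\tau<\infty)=1$. A nonnegative test martingale for $H$ is a nonnegative adapted process that is a martingale under every $P\in H$ with initial value at most one. A dynamic intersection $e$-process collection is a family $\mathbf E=(E^S_t)_{t\ge0,\ S\subseteq\mathcal I,\ 0<|S|<\infty}$ such that $E^S$ is an $e$-process for $H_S$ for each nonempty finite $S$ (no relation between different $S$ is required). The closure family is $\mathfrak R_{\alpha,t}(\mathbf E)=\{R\subseteq I_t:\ \mathrm{FDP}_S(R)\le\alpha E^S_t\text{ for every nonempty }S\subseteq I_t\}$. It controls simultaneous stopped FDR at level $\alpha$ if $\mathbb E_P[\max_{R\in\mathfrak R_{\alpha,\tau}(\mathbf E)}\mathrm{FDP}_{\mathcal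 N(P)}(R)]\le\alpha$ for every $P\in\mathcal M$ and every $(\mathcal F_t)$-stopping time $\tau$ with $P(\tau<\infty)=1$. *)

(* Defs.v *)
From HB Require Import structures.
From mathcomp Require Import all_boot all_order all_algebra.
From mathcomp Require Import all_classical all_reals all_analysis.

Set Implicit Arguments.
Unset Strict Implicit.
Unset Printing Implicit Defensive.

Import Order.TTheory GRing.Theory Num.Theory.

Local Open Scope classical_set_scope.
Local Open Scope ring_scope.

Definition is_filtration (d : measure_display) (T : measurableType d)
    (F : nat -> set (set T)) : Prop :=
  [/\ forall t, sigma_algebra setT (F t),
      forall t, F t `<=` measurable &
      forall s t, (s <= t)%N -> F s `<=` F t].

Definition adapted (R : realType) (T : Type) (F : nat -> set (set T))
    (X : nat -> T -> R) : Prop :=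
  forall t (B : set R), measurable B -> F t (X t @^-1` B).

(* A random time takes values in N_0 + {oo}, with None standing for oo. *)
Definition finite_at (T : Type) (tau : T -> option nat) : set T :=
  [set w | tau w != None].

Definition stopping_time (T : Type) (F : nat -> set (set T))
    (tau : T -> option nat) : Prop :=
  forall t, F t [set w | exists2 s, tau w = Some s & (s <= t)%N].

(* X_tau. The value 0 on {tau = oo} is a convention: stopped values are only
   used below for times that are almost surely finite. *)
Definition stopped (R : realType) (T : Type) (X : nat -> T -> R)
    (tau : T -> option nat) (w : T) : R :=
  if tau w is Some t then X t w else 0.

(* Y is a version of the conditional expectation E_P[X | G]. *)
Definition is_cond_expectation (R : realType) (d : measure_display)
    (T : measurableType d) (P : probability T R) (G : set (set T))
    (X Y : T -> R) : Prop :=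
  [/\ forall B : set R, measurable B -> G (Y @^-1` B),
      P.-integrable setT (EFin \o Y) &
      forall A, G A ->
        (\int[P]_(w in A) (Y w)%:E = \int[P]_(w in A) (X w)%:E)%E].

Definition martingale (R : realType) (d : measure_display)
    (T : measurableType d) (F : nat -> set (set T)) (P : probability T R)
    (X : nat -> T -> R) : Prop :=
  [/\ adapted F X,
      forall t, P.-integrable setT (EFin \o X t) &
      forall s t, (s <= t)%N -> is_cond_expectation P (F s) (X t) (X s)].

Definition test_martingale (R : realType) (d : measure_display)
    (T : measurableType d) (F : nat -> set (set T))
    (H : set (probability T R)) (X : nat -> T -> R) : Prop :=
  [/\ forall t w, 0 <= X t w,
      adapted F X,
      forall P, H P -> martingale F P X &
      forall w, X 0%N w <= 1].

Definition e_process (R : realType) (d : measure_display)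
    (T : measurableType d) (F : nat -> set (set T))
    (H : set (probability T R)) (X : nat -> T -> R) : Prop :=
  [/\ forall t w, 0 <= X t w,
      adapted F X &
      forall P, H P -> forall tau, stopping_time F tau ->
        P (finite_at tau) = 1%E -> ('E_P[stopped X tau] <= 1)%E].

Definition intersection_null (R : realType) (d : measure_display)
    (T : measurableType d) (I : finType) (H : I -> set (probability T R))
    (S : {set I}) : set (probability T R) :=
  \bigcap_(i in [set` S]) H i.

Definition true_nulls (R : realType) (d : measure_display)
    (T : measurableType d) (I : finType) (H : I -> set (probability T R))
    (P : probability T R) : {set I} :=
  finset (fun i => `[< H i P >]).

Definition active_sets (I : finType) (act : nat -> {set I}) : Prop :=
  (forall s t, (s <= t)%N -> act s \subset act t) /\
  (forall i, exists t, i \in act t).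

(* E S t is the value at time t of the process attached to S; the process
   E set0 is never used. *)
Definition dynamic_intersection_e_collection (R : realType)
    (d : measure_display) (T : measurableType d) (I : finType)
    (F : nat -> set (set T)) (H : I -> set (probability T R))
    (E : {set I} -> nat -> T -> R) : Prop :=
  forall S : {set I}, (0 < #|S|)%N -> e_process F (intersection_null H S) (E S).

Definition FDP (R : realType) (I : finType) (S A : {set I}) : R :=
  #|S :&: A|%:R / (maxn #|A| 1)%:R.

Definition e_closure (R : realType) (T : Type) (I : finType)
    (act : nat -> {set I}) (E : {set I} -> nat -> T -> R) (alpha : R)
    (t : nat) (w : T) : {set {set I}} :=
  finset (fun A : {set I} =>
    (A \subset act t) &&
    [forall S : {set I},
       ((0 < #|S|)%N && (S \subset act t)) ==>
       (FDP R S A <= alpha * E S t w)]).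

(* For nonnegative E the closure contains the empty set, whose FDP is 0, so the
   neutral element 0 does not change the maximum. *)
Definition max_FDP (R : realType) (T : Type) (I : finType)
    (act : nat -> {set I}) (E : {set I} -> nat -> T -> R) (alpha : R)
    (S : {set I}) (t : nat) (w : T) : R :=
  \big[Num.max/0]_(A in e_closure act E alpha t w) FDP R S A.

Definition controls_stopped_FDR (R : realType) (d : measure_display)
    (T : measurableType d) (I : finType) (F : nat -> set (set T))
    (M : set (probability T R)) (H : I -> set (probability T R))
    (act : nat -> {set I}) (E : {set I} -> nat -> T -> R) (alpha : R) : Prop :=
  forall P, M P -> forall tau, stopping_time F tau ->
    P (finite_at tau) = 1%E ->
    ('E_P[stopped (max_FDP act E alpha (true_nulls H P)) tau] <= alpha%:E)%E.

(* Main.v *)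
Require Import Defs.
From HB Require Import structures.
From mathcomp Require Import all_boot all_order all_algebra.
From mathcomp Require Import all_classical all_reals all_analysis.
From mathcomp Require Import lra.

Import Order.TTheory GRing.Theory Num.Theory.

Local Open Scope classical_set_scope.
Local Open Scope ring_scope.

(** The counterexample: an e-process for a fixed intersection is guarded against
    stopping times, but the closure at a random time also looks at a random
    active set, so the stopping time can choose which e-process is consulted,
    and no fixed-intersection martingale sees that choice.

    A single fair coin is revealed at time 1, hypothesis 0 becomes active at
    time 1 and hypothesis 1 at time 2; both nulls are true. For S = {0} the
    process E^S doubles its unit stake on heads and loses it on tails; for
    S = {1} and S = {0, 1} it does the opposite. Each is a martingale started
    at 1. On heads stop at time 1: the only active intersection is {0}, its
    process equals 2, and rejecting {0} meets the threshold 1 <= 2 / 2. On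
    tails stop at time 2: the intersections that contain 1 all have value 2, so
    rejecting {1} meets the thresholds, since {0} constrains it only through an
    FDP of 0. Either way the closure contains a lone false rejection, so
    the largest false discovery proportion is 1 surely ([max_FDP_alternating_time]).

    A bet is an e-process ([e_process_bet]) because the filtration is trivial at
    time 0: a stopping time either stops there surely or surely does not, and the bet
    does not move after time 1. *)

Lemma FDP_le1 (R : realType) (I : finType) (S A : {set I}) : FDP R S A <= 1.
Proof.
rewrite /FDP ler_pdivrMr ?mul1r ?ltr0n ?leq_max ?orbT // ler_nat.
by rewrite leq_max subset_leq_card ?finset.subsetIr.
Qed.

Lemma FDP_set1 (R : realType) (I : finType) (S : {set I}) (i : I) :
  FDP R S [set i]%SET = (i \in S)%:R.
Proof.
rewrite /FDP cards1 maxnn divr1; congr (_%:R).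
case: (boolP (i \in S)) => iS.
  by rewrite (finset.setIidPr _) ?cards1 // finset.sub1set.
by apply/eqP; rewrite cards_eq0 finset.setI_eq0 disjoint_sym disjoints1.
Qed.

(** Rejecting a single hypothesis is constrained only by the active
    intersections that contain it, the FDP being 0 for the others. *)
Lemma set1_in_e_closure (R : realType) (T : Type) (I : finType)
    (act : nat -> {set I}) (E : {set I} -> nat -> T -> R) (alpha : R)
    (t : nat) (w : T) (i : I) :
    0 <= alpha -> (forall S, 0 <= E S t w) -> i \in act t ->
    (forall S : {set I}, i \in S -> S \subset act t -> 1 <= alpha * E S t w) ->
  [set i]%SET \in e_closure act E alpha t w.
Proof.
move=> alpha0 E0 iact E1; rewrite inE finset.sub1set iact /=.
apply/forallP => S; apply/implyP => /andP[_ Sact].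
rewrite FDP_set1; case: (boolP (i \in S)) => iS; first exact: E1.
exact: mulr_ge0.
Qed.

(** One admissible rejection of a single true null is enough to push the maximum
    to its upper bound. *)
Lemma max_FDP_eq1 (R : realType) (T : Type) (I : finType)
    (act : nat -> {set I}) (E : {set I} -> nat -> T -> R) (alpha : R)
    (t : nat) (w : T) (i : I) (S : {set I}) :
    i \in S -> [set i]%SET \in e_closure act E alpha t w ->
  max_FDP act E alpha S t w = 1.
Proof.
move=> iS iR; apply/eqP; rewrite eq_le; apply/andP; split.
  by apply: bigmax_le => // A _; exact: FDP_le1.
apply: (bigmax_sup [set i]%SET) => //.
by rewrite FDP_set1 iS.
Qed.

Definition fair_coin (R : realType) : probability bool R :=
  bernoulli_prob 2^-1.

Lemma integral_fair_coin (R : realType) (f : bool -> R) :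
    (forall w, 0 <= f w) ->
  (\int[fair_coin R]_w (f w)%:E)%E = (2^-1 * (f true + f false))%:E.
Proof.
move=> f0; rewrite integral_bernoulli_prob; last by move=> w; rewrite lee_fin.
  by rewrite -!EFinM -EFinD; congr EFin; rewrite /unstable.onem; lra.
by apply/andP; split; lra.
Qed.

Lemma integrable_fair_coin (R : realType) (f : bool -> R) :
    (forall w, 0 <= f w) -> (fair_coin R).-integrable setT (EFin \o f).
Proof.
move=> f0; apply/integrableP; split; first by [].
under eq_integral do rewrite /= ger0_norm ?f0 //.
by rewrite integral_fair_coin // ltry.
Qed.

Definition coin_filtration (t : nat) : set (set bool) :=
  [set A | t = 0%N -> A = set0 \/ A = setT].

Lemma coin_filtrationP : is_filtration coin_filtration.
Proof.
split=> // [t|s t st A AF t0]; last by apply: AF; move: st; rewrite t0; case: s.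
split.
- by left.
- move=> A AF t0; case: (AF t0) => ->; last by left; rewrite setDv.
  by right; rewrite setD0.
- move=> A AF t0; case: (pselect (exists n, A n = setT)) => [[n An]|nA].
    by right; rewrite -subTset -An; exact: bigcup_sup.
  left; apply: bigcup0 => n _; case: (AF n t0) => // An.
  by exfalso; apply: nA; exists n.
Qed.

(** The wealth of a gambler who stakes one unit at even odds on the outcome c of
    the coin tossed at time 1. *)
Definition bet (R : realType) (c : bool) (t : nat) (w : bool) : R :=
  if t is 0 then 1 else if w == c then 2 else 0.

Lemma bet_ge0 (R : realType) c t w : 0 <= bet R c t w.
Proof. by case: t => [|t] //=; case: ifP. Qed.

Lemma integral_bet (R : realType) c t :
  (\int[fair_coin R]_w (bet R c t w)%:E = 1)%E.
Proof.
rewrite integral_fair_coin; last by move=> w; exact: bet_ge0.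
by congr EFin; case: t => [|t] /=; case: c => /=; lra.
Qed.

(** At time 0 the wealth is constant, so its preimages are empty or full; this is
    all that the filtration demands. *)
Lemma adapted_bet (R : realType) c : adapted coin_filtration (bet R c).
Proof.
move=> t B _ -> /=; rewrite preimage_cst.
by case: ifP => _; [right|left].
Qed.

(** The only real step is from time 0 to a later time, where the conditioning
    events are empty or full and the identity is equality of expectations. *)
Lemma martingale_bet (R : realType) c :
  martingale coin_filtration (fair_coin R) (bet R c).
Proof.
split; first exact: adapted_bet.
  by move=> t; apply: integrable_fair_coin => w; exact: bet_ge0.
move=> s t st; split; first exact: adapted_bet.
  by apply: integrable_fair_coin => w; exact: bet_ge0.
case: s st => [_|s]; last by case: t.
move=> A /(_ erefl)[] ->; first by rewrite !integral_set0.
by rewrite !integral_bet.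
Qed.

(** The event that tau = 0 is empty or full, so the stopped wealth is bounded
    everywhere by the wealth at one deterministic time: time 1 if tau never
    stops at once, time 0 otherwise. *)
Lemma e_process_bet (R : realType) c (H : set (probability bool R)) :
  H `<=` [set fair_coin R] -> e_process coin_filtration H (bet R c).
Proof.
move=> HP; split; [exact: bet_ge0 | exact: adapted_bet |].
move=> _ /HP -> tau /(_ 0%N) /(_ erefl) tau0 _.
have [t Xt] : exists t, forall w, stopped (bet R c) tau w <= bet R c t w.
  (* On tau = oo the stopped value is 0, whence a bound and not an equality. *)
  case: tau0 => tau0.
    exists 1%N => w; rewrite /stopped.
    case Ew: (tau w) => [[|t]|] //; last exact: bet_ge0.
    suff : [set w | exists2 s, tau w = Some s & (s <= 0)%N] w by rewrite tau0.
    by exists 0%N.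
  exists 0%N => w.
  have : [set w | exists2 s, tau w = Some s & (s <= 0)%N] w by rewrite tau0.
  by move=> [s]; rewrite leqn0 /stopped => -> /eqP ->.
rewrite unlock -(integral_bet R c t).
have X0 w : 0 <= stopped (bet R c) tau w.
  by rewrite /stopped; case: (tau w) => // s; exact: bet_ge0.
by apply: ge0_le_integral => // w _; rewrite lee_fin ?bet_ge0.
Qed.

Lemma test_martingale_bet (R : realType) c (H : set (probability bool R)) :
  H `<=` [set fair_coin R] -> test_martingale coin_filtration H (bet R c).
Proof.
move=> HP; split=> //; [exact: bet_ge0|exact: adapted_bet|].
by move=> _ /HP ->; exact: martingale_bet.
Qed.

Definition two_step_activation (t : nat) : {set 'I_2} :=
  [set i : 'I_2 | (i < t)%N]%SET.

(** The intersections that can veto a lone rejection of 1, namely {1} and {0, 1},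
    all win when {0} loses; heads is [true]. *)
Definition bet_collection (R : realType) (S : {set 'I_2}) : nat -> bool -> R :=
  bet R (S == [set ord0]%SET).

(** Stop before hypothesis 1 is active when the bet of {0} has won, and wait for
    it when that bet has lost. *)
Definition alternating_time (w : bool) : option nat :=
  Some (if w then 1 else 2)%N.

Lemma stopping_time_alternating : stopping_time coin_filtration alternating_time.
Proof.
move=> t ->; left; rewrite -subset0 => w [s].
by rewrite /alternating_time => -[<-]; case: w.
Qed.

Lemma max_FDP_alternating_time (R : realType) (w : bool) :
  stopped (max_FDP two_step_activation (bet_collection R) 2^-1
             [set: 'I_2]%SET) alternating_time w = 1.
Proof.
have a0 : 0 <= 2^-1 :> R by lra.
rewrite /stopped /=; case: w.
  apply: (@max_FDP_eq1 _ _ _ _ _ _ _ _ ord0); first by rewrite inE.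
  apply: set1_in_e_closure => // [S||S S0 S1]; [exact: bet_ge0| by rewrite inE|].
  (* At time 1 the intersection {0, 1}, whose bet has lost, is not yet active. *)
  suff -> : S = [set ord0]%SET by rewrite /bet_collection /= eqxx; lra.
  apply/eqP; rewrite finset.eqEsubset finset.sub1set S0 andbT.
  apply: (fintype.subset_trans S1); apply/fintype.subsetP => i.
  by rewrite !inE ltnS leqn0.
apply: (@max_FDP_eq1 _ _ _ _ _ _ _ _ ord_max); first by rewrite inE.
apply: set1_in_e_closure => // [S||S S1 _]; [exact: bet_ge0| by rewrite inE|].
have /negPf SN0 : S != [set ord0]%SET.
  by apply: contraTN S1 => /eqP ->; rewrite inE.
by rewrite /bet_collection /= SN0 /=; lra.
Qed.

Theorem proposition3p2 (R : realType) :
  exists (d : measure_display) (T : measurableType d)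
         (F : nat -> set (set T)) (M : set (probability T R))
         (H : 'I_2 -> set (probability T R)) (act : nat -> {set 'I_2})
         (E : {set 'I_2} -> nat -> T -> R),
    [/\ is_filtration F,
        (forall i, H i `<=` M),
        active_sets act &
        dynamic_intersection_e_collection F H E] /\
    (forall S : {set 'I_2}, (0 < #|S|)%N ->
       test_martingale F (intersection_null H S) (E S)) /\
    (exists P : probability T R,
       [/\ M P, (forall i, H i P) &
         exists tau : T -> option nat,
           [/\ stopping_time F tau,
               P (finite_at tau) = 1%E &
               ('E_P[stopped (max_FDP act E 2^-1 [set: 'I_2]%SET) tau]
                = 1)%E]]) /\
    ~ controls_stopped_FDR F M H act E 2^-1.
Proof.
pose H (_ : 'I_2) : set (probability bool R) := [set fair_coin R].
exists _, bool, coin_filtration, [set fair_coin R], H.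
exists two_step_activation, (bet_collection R).
have HS (S : {set 'I_2}) : (0 < #|S|)%N ->
    intersection_null H S `<=` [set fair_coin R].
  by move=> /card_gt0P[i iS] P /(_ i iS).
have finP : fair_coin R (finite_at alternating_time) = 1%E.
  by rewrite -(probability_setT (fair_coin R)); congr (_ _); apply/seteqP; split.
have FDR1 : ('E_(fair_coin R)[
    stopped (max_FDP two_step_activation (bet_collection R) 2^-1
               [set: 'I_2]%SET) alternating_time] = 1)%E.
  rewrite (_ : stopped _ _ = cst 1) ?expectation_cst //.
  by apply/funext => w; exact: max_FDP_alternating_time.
split; last split; last split.
- split; [exact: coin_filtrationP | by move=> i P | | ].
    split=> [s t st|i]; last by exists 2%N; rewrite inE.
    by apply/fintype.subsetP => i; rewrite !inE => /leq_trans; apply.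
  by move=> S /HS; exact: e_process_bet.
- by move=> S /HS; exact: test_martingale_bet.
- exists (fair_coin R); split=> //; exists alternating_time.
  by split=> //; exact: stopping_time_alternating.
- move=> /(_ _ erefl _ stopping_time_alternating finP).
  rewrite (_ : true_nulls H _ = [set: 'I_2]%SET); last first.
    by apply/finset.setP => i; rewrite !inE; apply/asboolP.
  by rewrite FDR1 lee_fin; lra.
Qed.
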